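(* Let $P(x)$ be a polynomial with real coefficients. Then there exists a triple of polynomials $(F_1(x),G_1(x),H_1(x))$ with real coefficients such that $$2\sum_{k=1}^{n}P(k)s_{k-1}=F_1(n)s_{n+1}+G_1(n)s_n+H_1(n)\qquad\text{for all } n\in\mathbb N.$$
   Context: $\mathbb N$ denotes the positive integers. Fix $a,b\in\mathbb N$ and $c_0,c_1\in\mathbb Z$ with $(c_0,c_1)\neq(0,0)$. The generalized Fibonacci sequence $(s_n)_{n\ge0}$ is defined by $s_0=c_0$, $s_1=c_1$, and $s_{n+1}=as_n+bs_{n-1}$ for all $n\in\mathbb N$. *)

(* Defs.v *)
From mathcomp Require Import all_boot all_order all_algebra.
From mathcomp Require Import reals.

Set Implicit Arguments.
Unset Strict Implicit.
Unset Printing Implicit Defensive.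

Import GRing.Theory.

Local Open Scope ring_scope.

Fixpoint gfib (a b : nat) (c0 c1 : int) (n : nat) {struct n} : int :=
  match n with
  | 0%N => c0
  | m.+1 => match m with
            | 0%N => c1
            | l.+1 => a%:Z * gfib a b c0 c1 m + b%:Z * gfib a b c0 c1 l
            end
  end.

(* Main.v *)
(* Summation by parts: [T n = F(n) s_(n+1) + G(n) s_n] satisfies
   [T (n+1) - T n = 2 P(n+1) s_n] as soon as [G(x) = b F(x+1) - 2 P(x+1)] and
   [b F(x+2) + a F(x+1) - F(x) = 2 P(x+2)].  The operator on the left of the
   last equation is multiplication by the nonzero constant [a + b - 1] up to
   terms of lower degree, hence surjective on polynomials. *)

Require Import Defs.
From mathcomp Require Import all_boot all_order all_algebra.
From mathcomp Require Import reals.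
From mathcomp Require Import zify ring.

Set Implicit Arguments.
Unset Strict Implicit.
Unset Printing Implicit Defensive.

Import GRing.Theory Num.Theory.

Local Open Scope ring_scope.

(** A shift of the variable preserves both size and leading coefficient, so the top terms cancel. *)
Lemma size_comp_polyXaddC_sub (R : idomainType) (p : {poly R}) (c : R) :
  (size (p \Po ('X + c%:P) - p)%R <= (size p).-1)%N.
Proof.
have szXc := size_XaddC c.
apply/leq_sizeP => j le_j; rewrite coefB.
have [lt_j|ge_j] := ltnP j (size p); last first.
  by rewrite !nth_default ?subr0 // size_comp_poly2.
have -> : j = (size p).-1 by lia.
rewrite -{1}(size_comp_poly2 p szXc) -!lead_coefE lead_coef_comp ?szXc //.
by rewrite lead_coefXaddC expr1n mulr1 subrr.
Qed.

Lemma shift_operator_surj (R : fieldType) (a b c d : R) (Q : {poly R}) :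
  a + b - 1 != 0 ->
  exists F : {poly R},
    b *: (F \Po ('X + d%:P)) + a *: (F \Po ('X + c%:P)) - F = Q.
Proof.
move=> e_neq0; have [n] := ubnP (size Q).
elim: n Q => // n IHn Q ltQ.
have [->|Q_neq0] := eqVneq Q 0.
  by exists 0; rewrite !comp_poly0 !scaler0 addr0 subr0.
(* [E] would be the solution if shifts acted trivially; [Q'] is the error, [Q] minus the operator at
   [E], and has smaller size. *)
pose E := (a + b - 1)^-1 *: Q.
pose Q' := - (b *: (E \Po ('X + d%:P) - E) + a *: (E \Po ('X + c%:P) - E)).
have szE : size E = size Q by rewrite size_scale ?invr_eq0.
have szQ' : (size Q' <= (size Q).-1)%N.
  rewrite size_polyN (leq_trans (size_polyD _ _)) // geq_max -szE.
  by rewrite !(leq_trans (size_scale_leq _ _)) ?size_comp_polyXaddC_sub.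
have QE : Q = (a + b - 1) *: E by rewrite scalerA divff ?scale1r.
have [|F defF] := IHn Q'.
  by rewrite (leq_ltn_trans szQ') // prednK ?size_poly_gt0.
exists (F + E); rewrite !comp_polyD QE.
transitivity (b *: (E \Po ('X + d%:P)) + a *: (E \Po ('X + c%:P)) - E + Q').
  by rewrite -defF -!mul_polyC; ring.
by rewrite /Q' -!mul_polyC !rmorphB !rmorphD /=; ring.
Qed.

Theorem theorem3p1 (R : realType) (a b : nat) (c0 c1 : int)
    (ha : (0 < a)%N) (hb : (0 < b)%N) (hc : (c0, c1) <> (0, 0))
    (P : {poly R}) :
  exists F1 G1 H1 : {poly R}, forall n : nat, (0 < n)%N ->
    2 * (\sum_(1 <= k < n.+1) P.[k%:R] * (gfib a b c0 c1 k.-1)%:~R)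
    = F1.[n%:R] * (gfib a b c0 c1 n.+1)%:~R
      + G1.[n%:R] * (gfib a b c0 c1 n)%:~R + H1.[n%:R].
Proof.
pose s n : R := (gfib a b c0 c1 n)%:~R.
have sSS n : s n.+2 = a%:R * s n.+1 + b%:R * s n.
  by rewrite /s [gfib _ _ _ _ n.+2]/= intrD !intrM.
have ab_neq0 : a%:R + b%:R - 1 != 0 :> R.
  by rewrite -natrD subr_eq0 pnatr_eq1; lia.
have [F defF] := shift_operator_surj 1 2 (2 *: (P \Po ('X + 2%:P))) ab_neq0.
have FE x :
    F.[x] = b%:R * F.[x + 1 + 1] + a%:R * F.[x + 1] - 2 * P.[x + 1 + 1].
  move/(congr1 (horner^~ x)): defF; rewrite !hornerE !horner_comp !hornerE /=.
  by move=> <-; ring.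
pose G := b%:R *: (F \Po ('X + 1%:P)) - 2 *: (P \Po ('X + 1%:P)).
have GE x : G.[x] = b%:R * F.[x + 1] - 2 * P.[x + 1].
  by rewrite /G !hornerE !horner_comp !hornerE.
(* The constant makes the identity hold at [n = 0], where the sum is empty, so the induction starts
   there. *)
exists F, G, (- (F.[0] * s 1%N + G.[0] * s 0%N))%:P => n _.
rewrite hornerC -!/(s _).
elim: n => [|n IHn]; first by rewrite big_nil mulr0 addrN.
rewrite big_nat_recr //= mulrDr IHn -!/(s _) sSS !GE.
(* The coefficients of [s n] agree by the choice of [G]; those of [s n.+1] agree by [FE] at [n],
   whose [x + 1 + 1] matches the argument that [GE] produces at [n.+1]. *)
rewrite -[n.+1%:R]natr1 (FE n%:R).
ring.
Qed.
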